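(* Let $(A,\{\mu_k\}_{k\ge1})$ be an $A_\infty[1]$-algebra over a field of characteristic $0$, $(M,\{\eta_k\}_{k\ge1})$ a bimodule over it, and let $(A,\{l_k\}_{k\ge1})$ and $(M,\{\rho_k\}_{k\ge1})$ be the $L_\infty[1]$-algebra and its representation obtained by symmetrization. If $T=\sum_{k\ge1}T_k$ is a homotopy relative Rota-Baxter operator on $(M,\{\eta_k\}_{k\ge1})$ over the $A_\infty[1]$-algebra $(A,\{\mu_k\}_{k\ge1})$, then $\Psi(T)$ is a homotopy relative Rota-Baxter operator on the module $(M,\{\rho_k\}_{k\ge1})$ over the $L_\infty[1]$-algebra $(A,\{l_k\}_{k\ge1})$.
   Context: $\epsilon(\sigma)$ denotes the Koszul sign of a permutation, $S_{(i,n-i)}$ the $(i,n-i)$-shuffles, $\overline T(V)=\bigoplus_{n\ge1}V^{\otimes n}$, $\overline S(V)$ the reduced (graded) symmetric algebra, $\mathrm{Hom}_n$ degree $n$ maps. Multilinear maps defined on products of $A$'s and $M$'s are extended by zero (graded symmetrically, in the symmetric case) to $A\oplus M$. $A_\infty[1]$-algebra: graded vector space $A$ with degree $1$ maps $\mu_k:A^{\otimes k}\to A$ with $\sum_{i+j=n+1}\sum_{\lambda=1}^j(-1)^{|a_1|+\cdots+|a_{\lambda-1}|}\mu_j(a_1,\ldots,a_{\lambda-1},\mu_i(a_\lambda,\ldots,a_{\lambda+i-1}),a_{\lambda+i},\ldots,a_n)=0$, $n\ge1$. A bimodule is a graded vector space $M$ with degree $1$ maps $\eta_k$ from the direct sum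 of all tensor products of $k-1$ copies of $A$ and one of $M$ (any order) to $M$, satisfying the same identities when exactly one $a_i\in M$, with $\mu$ replaced by $\eta$ when it has an argument in $M$. Associative side: $\bigoplus_n\mathrm{Hom}_n(\overline T(A\oplus M),A\oplus M)$ has the graded Lie bracket $[f,g]=f\circ g-(-1)^{mn}g\circ f$ ($f$ of degree $m$ and arity $k$, $g$ of degree $n$ and arity $l$), $(f\circ g)(v_1,\ldots,v_{k+l-1})=\sum_{i=1}^k(-1)^{n(|v_1|+\cdots+|v_{i-1}|)}f(v_1,\ldots,v_{i-1},g(v_i,\ldots,v_{i+l-1}),\ldots,v_{k+l-1})$. With $\triangle=\sum_k(\mu_k+\eta_k)$ and $P$ the projection onto $\bigoplus_n\mathrm{Hom}_n(\overline T(M),A)$, a homotopy relative Rota-Baxter operator on $M$ over the $A_\infty[1]$-algebra $A$ is $T\in\mathrm{Hom}_0(\overline T(M),A)$ with $\sum_{n\ge1}\frac1{n!}P[\cdots[[\triangle,T],T],\ldots,T]=0$ ($n$ copies of $T$). Lie side: $\bigoplus_n\mathrm{Hom}_n(\overline S(V),V)$ has the Nijenhuis-Richardson bracket $[f,g]=f\circ g-(-1)^{mn}g\circ f$, $(f\circ g)(v_1,\ldots,v_{k+l-1})=\sum_{\sigma\in S_{(l,k-1)}}\epsilon(\sigma)f(g(v_{\sigma(1)},\ldots,v_{\sigma(l)}),v_{\sigma(l+1)},\ldots,v_{\sigma(k+l-1)})$. An $L_\infty[1]$-algebra structure on $W$ is $l=\sum_{k\ge1}l_k$ of degree $1$ with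 $[l,l]=0$; a representation on $V$ is a family of degree $1$ maps $\rho_k:S^{k-1}(W)\otimes V\to V$ such that $\triangle'=\sum_k(l_k+\rho_k)$ satisfies $[\triangle',\triangle']=0$ on $W\oplus V$. A homotopy relative Rota-Baxter operator on $V$ over $W$ is $T\in\mathrm{Hom}_0(\overline S(V),W)$ with $\sum_{n\ge1}\frac1{n!}P'[\cdots[[\triangle',T],T],\ldots,T]=0$, where $P'$ is the projection onto $\bigoplus_n\mathrm{Hom}_n(\overline S(V),W)$. (On each tensor or symmetric power these sums are finite.) Symmetrization: $l_k(a_1,\ldots,a_k)=\sum_{\sigma\in S_k}\epsilon(\sigma)\mu_k(a_{\sigma(1)},\ldots,a_{\sigma(k)})$ for $a_i\in A$; $\rho_k(a_1,\ldots,a_k)=\sum_{\sigma\in S_k}\epsilon(\sigma)\eta_k(a_{\sigma(1)},\ldots,a_{\sigma(k)})$ for $a_1,\ldots,a_{k-1}\in A$, $a_k\in M$; these form an $L_\infty[1]$-algebra and a representation. The map $\Psi$ is $\Psi(f)(v_1,\ldots,v_k)=\sum_{\sigma\in S_k}\epsilon(\sigma)f(v_{\sigma(1)},\ldots,v_{\sigma(k)})$ for $f$ of arity $k$. *)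

(* Defs.v *)
From mathcomp Require Import all_boot all_order all_fingroup all_algebra.

Set Implicit Arguments.
Unset Strict Implicit.
Unset Printing Implicit Defensive.

Import GRing.Theory.
Local Open Scope ring_scope.

Notation gvect K := (int -> lmodType K).

Section GradedMaps.
Variable K : fieldType.

(* A homogeneous element is stored with its degree: x = (tag x, tagged x).  *)
Definition helt (V : gvect K) : Type := {d : int & V d}.

Definition helem (V : gvect K) (d : int) (x : V d) : helt V :=
  Tagged (fun i : int => V i) x.

Definition deg (V : gvect K) (x : helt V) : int := tag x.

Definition degs (V : gvect K) (v : seq (helt V)) : int := \sum_(x <- v) deg x.

(* The component of arity k of f : mmap V W is the restriction of f to words *)
(* of length k >= 1, given on homogeneous arguments; f v e is the component  *)
(* in degree e of f(v). The value at the empty word is irrelevant.           *)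
Definition mmap (V W : gvect K) : Type := seq (helt V) -> forall e, W e.

Section Maps.
Variables V W : gvect K.

Definition addm (f g : mmap V W) : mmap V W := fun v e => f v e + g v e.

Definition multilinear (f : mmap V W) : Prop :=
  forall (u w : seq (helt V)) (d e : int),
    linear (fun x : V d => f (u ++ helem x :: w) e).

Definition has_degree (n : int) (f : mmap V W) : Prop :=
  forall (v : seq (helt V)) (e : int),
    v != [::] -> e != n + degs v -> f v e = 0.

(* Hom_n(Tbar(V), W) *)
Definition HomT (n : int) (f : mmap V W) : Prop :=
  multilinear f /\ has_degree n f.

(* f(v) as a homogeneous element, for f of degree n *)
Definition hval (n : int) (f : mmap V W) (v : seq (helt V)) : helt W :=
  helem (f v (n + degs v)).

(* The word v_{s 0}, ..., v_{s (k-1)}. *)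
Definition permw (v : seq (helt V)) (s : 'S_(size v)) : seq (helt V) :=
  [seq tnth (in_tuple v) (s i) | i <- enum 'I_(size v)].

(* v_0 ... v_{k-1} = koszul s * v_{s 0} ... v_{s (k-1)} in S(V); the         *)
(* signature of s is not included.                                           *)
Definition koszul (v : seq (helt V)) (s : 'S_(size v)) : K :=
  \prod_(i < size v) \prod_(j < size v | (i < j)%N && (s j < s i)%N)
    (-1) ^ (deg (tnth (in_tuple v) (s i)) * deg (tnth (in_tuple v) (s j))).

Definition gsymmetric (f : mmap V W) : Prop :=
  forall (v : seq (helt V)) (s : 'S_(size v)) (e : int),
    f v e = koszul s *: f (permw s) e.

(* Hom_n(Sbar(V), W), seen as graded symmetric multilinear maps *)
Definition HomS (n : int) (f : mmap V W) : Prop :=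
  HomT n f /\ gsymmetric f.

Definition Psi (f : mmap V W) : mmap V W :=
  fun v e => \sum_(s : 'S_(size v)) koszul s *: f (permw s) e.

End Maps.

Section Brackets.
Variable V : gvect K.

(* f o g for g of degree n; g is fed the l letters following the first i.    *)
Definition circT (n : int) (f g : mmap V V) : mmap V V := fun v e =>
  \sum_(1 <= l < (size v).+1) \sum_(0 <= i < (size v - l).+1)
    (-1) ^ (n * degs (take i v)) *:
      f (take i v ++ hval n g (take l (drop i v)) :: drop (i + l) v) e.

Definition brT (m n : int) (f g : mmap V V) : mmap V V := fun v e =>
  circT n f g v e - (-1) ^ (m * n) *: circT m g f v e.

(* (l, k - l)-shuffles of k letters *)
Definition is_shuffle (k l : nat) (s : 'S_k) : bool :=
  [forall i : 'I_k, forall j : 'I_k,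
    ((i < j) && ((j < l) || (l <= i)) ==> (s i < s j))%N].

Definition circS (n : int) (f g : mmap V V) : mmap V V := fun v e =>
  \sum_(1 <= l < (size v).+1) \sum_(s : 'S_(size v) | is_shuffle l s)
    koszul s *: f (hval n g (take l (permw s)) :: drop l (permw s)) e.

Definition brS (m n : int) (f g : mmap V V) : mmap V V := fun v e =>
  circS n f g v e - (-1) ^ (m * n) *: circS m g f v e.

End Brackets.

Section DirectSum.
Variables A M : gvect K.

Definition gsum : gvect K := fun d => (A d * M d)%type.

Definition inl_h (a : helt A) : helt gsum :=
  @helem gsum (deg a) (tagged a, 0).
Definition inr_h (m : helt M) : helt gsum :=
  @helem gsum (deg m) (0, tagged m).
Definition prl_h (x : helt gsum) : helt A := @helem A (deg x) (tagged x).1.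
Definition prr_h (x : helt gsum) : helt M := @helem M (deg x) (tagged x).2.

(* Maps with arguments in A or M, extended by zero to A (+) M *)

Definition extA (mu : mmap A A) : mmap gsum gsum :=
  fun v e => (mu (map prl_h v) e, 0).

Definition extMA (T : mmap M A) : mmap gsum gsum :=
  fun v e => (T (map prr_h v) e, 0).

(* eta u m w: the argument in M is m, preceded by u and followed by w.       *)
Definition bimap : Type :=
  seq (helt A) -> helt M -> seq (helt A) -> forall e, M e.

Definition extB (eta : bimap) : mmap gsum gsum := fun v e =>
  (0, \sum_(i < size v)
        eta (map prl_h (take i v)) (prr_h (tnth (in_tuple v) i))
            (map prl_h (drop i.+1 v)) e).

(* rho u m: maps S^{k-1}(A) (x) M -> M *)
Definition repmap : Type := seq (helt A) -> helt M -> forall e, M e.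

(* Graded symmetric extension: the letter at position i is moved to the end. *)
Definition extR (rho : repmap) : mmap gsum gsum := fun v e =>
  (0, \sum_(i < size v)
        (-1) ^ (deg (tnth (in_tuple v) i) * degs (drop i.+1 v)) *:
          rho (map prl_h (take i v ++ drop i.+1 v))
              (prr_h (tnth (in_tuple v) i)) e).

Definition projMA (X : mmap gsum gsum) : mmap M A :=
  fun v e => (X (map inr_h v) e).1.

Definition triT (mu : mmap A A) (eta : bimap) : mmap gsum gsum :=
  addm (extA mu) (extB eta).

Definition triS (l : mmap A A) (rho : repmap) : mmap gsum gsum :=
  addm (extA l) (extR rho).

Definition symm_rep (eta : bimap) : repmap := fun u m e =>
  (Psi (extB eta) (rcons (map inl_h u) (inr_h m)) e).2.

Definition is_bimap (eta : bimap) : Prop :=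
  [/\ forall u1 u2 m w d e,
        linear (fun x : A d => eta (u1 ++ helem x :: u2) m w e),
      forall u w d e, linear (fun x : M d => eta u (helem x) w e),
      forall u m w1 w2 d e,
        linear (fun x : A d => eta u m (w1 ++ helem x :: w2) e)
    & forall u m w e, e != 1 + (degs u + deg m + degs w) -> eta u m w e = 0].

Definition is_repmap (rho : repmap) : Prop :=
  [/\ forall u1 u2 m d e,
        linear (fun x : A d => rho (u1 ++ helem x :: u2) m e),
      forall u d e, linear (fun x : M d => rho u (helem x) e),
      forall u (s : 'S_(size u)) m e,
        rho u m e = koszul s *: rho (permw s) m e
    & forall u m e, e != 1 + (degs u + deg m) -> rho u m e = 0].

End DirectSum.

(* Sum_{n >= 1} u n = 0 on each arity, where the sum is finite: on words of  *)
(* a given length the partial sums are eventually 0.                         *)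
Definition series0 (V W : gvect K) (u : nat -> mmap V W) : Prop :=
  forall k : nat, (0 < k)%N ->
  exists N : nat, forall p : nat, (N <= p)%N ->
  forall (v : seq (helt V)) (e : int), size v = k ->
    \sum_(1 <= n < p) u n v e = 0.

Definition is_Ainf (A : gvect K) (mu : mmap A A) : Prop :=
  HomT 1 mu /\
  forall (v : seq (helt A)) (e : int), v != [::] -> circT 1 mu mu v e = 0.

Definition is_bimodule (A M : gvect K) (mu : mmap A A) (eta : bimap A M) :
    Prop :=
  is_bimap eta /\
  forall (u : seq (helt A)) (m : helt M) (w : seq (helt A)) (e : int),
    circT 1 (triT mu eta) (triT mu eta)
      (map (@inl_h A M) u ++ inr_h A m :: map (@inl_h A M) w) e = 0.

Definition is_Linf (W : gvect K) (l : mmap W W) : Prop :=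
  HomS 1 l /\
  forall (v : seq (helt W)) (e : int), v != [::] -> brS 1 1 l l v e = 0.

Definition is_representation (W V : gvect K) (l : mmap W W)
    (rho : repmap W V) : Prop :=
  is_repmap rho /\
  forall (v : seq (helt (gsum W V))) (e : int), v != [::] ->
    brS 1 1 (triS l rho) (triS l rho) v e = 0.

(* [...[[X, T], T], ..., T] with n copies of T, X of degree 1, T of degree 0 *)
Definition iterbrT (V : gvect K) (T X : mmap V V) (n : nat) : mmap V V :=
  iter n (fun Y => brT 1 0 Y T) X.

Definition iterbrS (V : gvect K) (T X : mmap V V) (n : nat) : mmap V V :=
  iter n (fun Y => brS 1 0 Y T) X.

Definition is_rRB_Ainf (A M : gvect K) (mu : mmap A A) (eta : bimap A M)
    (T : mmap M A) : Prop :=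
  [/\ is_Ainf mu, is_bimodule mu eta, HomT 0 T
    & series0 (fun n v e =>
        (n`!%:R : K)^-1 *: projMA (iterbrT (extMA T) (triT mu eta) n) v e)].

Definition is_rRB_Linf (W V : gvect K) (l : mmap W W) (rho : repmap W V)
    (T : mmap V W) : Prop :=
  [/\ is_Linf l, is_representation l rho, HomS 0 T
    & series0 (fun n v e =>
        (n`!%:R : K)^-1 *: projMA (iterbrS (extMA T) (triS l rho) n) v e)].

End GradedMaps.

(* Main.v *)
(* Psi is a morphism from the bracket on Hom(Tbar V, V) to the
   Nijenhuis-Richardson bracket: a permutation of v_1 ... v_k together with a
   consecutive block a of the permuted word is the same as an unshuffle of the
   letters into those of a and the others, an ordering of each part, and a
   place where a is inserted.  Psi also commutes with the extensions by zero
   to A (+) M and with the projection onto maps from M to A, so it carries each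
   of the defining identities on the associative side to the corresponding one
   on the symmetric side. *)
Require Import Defs.
From mathcomp Require Import all_boot all_order all_fingroup all_algebra.
From mathcomp Require Import zify.

Set Implicit Arguments.
Unset Strict Implicit.
Unset Printing Implicit Defensive.

Import GRing.Theory.
Local Open Scope ring_scope.

(** The sums over ['S_(size v)] resist induction: their index type depends on the word, and the
    Koszul sign is a product over inversions. They are replaced by formal sums of words built by
    recursion on v, where a permutation arises by inserting the first letter into a permutation of
    the others and an unshuffle by sending each letter to one of two parts. Signs then accumulate as
    letters pass one another, and the combinatorics of the bracket morphism becomes the single
    induction [syms_splits]. A second obstacle is the representation: the bimodule identity is
    assumed only on words with one letter in M and the others in A, while the symmetric identity is
    required on all words of A (+) M. The operator [mark] expands a word into its components with
    exactly one letter in M; it fixes the M-component of the structure map and of the square of that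
    map, which reduces the general identity to the assumed one. *)

Section FormalSums.
Variable K : fieldType.

(* [L] is a formal linear combination of elements of X, on which F is extended
   linearly. *)
Definition fsum (X : Type) (E : lmodType K) (L : seq (K * X)) (F : X -> E) :
    E :=
  \sum_(p <- L) p.1 *: F p.2.

Definition fbind (X Y : Type) (L : seq (K * X)) (h : X -> seq (K * Y)) :
    seq (K * Y) :=
  flatten [seq [seq (p.1 * q.1, q.2) | q <- h p.2] | p <- L].

Section Theory.
Variables (X Y : Type) (E : lmodType K).
Implicit Types (L : seq (K * X)) (F G : X -> E).

Lemma fsum_nil F : fsum [::] F = 0.
Proof. by rewrite /fsum big_nil. Qed.

Lemma fsum_cons c x L F : fsum ((c, x) :: L) F = c *: F x + fsum L F.
Proof. by rewrite /fsum big_cons. Qed.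

Lemma fsum_bind L (h : X -> seq (K * Y)) (F : Y -> E) :
  fsum (fbind L h) F = fsum L (fun x => fsum (h x) F).
Proof.
rewrite /fsum /fbind big_flatten big_map; apply: eq_bigr => p _.
by rewrite big_map scaler_sumr; apply: eq_bigr => q _; rewrite scalerA.
Qed.

Lemma eq_fsum L F G : F =1 G -> fsum L F = fsum L G.
Proof. by move=> FG; apply: eq_bigr => p _; rewrite FG. Qed.

Lemma fsumD L F G : fsum L (fun x => F x + G x) = fsum L F + fsum L G.
Proof. by rewrite /fsum -big_split; apply: eq_bigr => p _; rewrite scalerDr. Qed.

Lemma fsumZ L c F : fsum L (fun x => c *: F x) = c *: fsum L F.
Proof.
by rewrite /fsum scaler_sumr; apply: eq_bigr => p _; rewrite !scalerA mulrC.
Qed.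

Lemma fsum0 L : fsum L (fun=> 0 : E) = 0.
Proof. by rewrite /fsum big1 // => p _; rewrite scaler0. Qed.

Lemma fsum_sum (I : Type) (r : seq I) (P : pred I) L (F : I -> X -> E) :
  fsum L (fun x => \sum_(i <- r | P i) F i x) =
  \sum_(i <- r | P i) fsum L (F i).
Proof.
by rewrite /fsum exchange_big; apply: eq_bigr => p _; rewrite scaler_sumr.
Qed.

Lemma exchange_fsum L (L' : seq (K * Y)) (F : X -> Y -> E) :
  fsum L (fun x => fsum L' (F x)) = fsum L' (fun y => fsum L (F^~ y)).
Proof.
rewrite {1}/fsum /fsum; under eq_bigr do rewrite scaler_sumr.
rewrite exchange_big; apply: eq_bigr => q _; rewrite scaler_sumr.
by apply: eq_bigr => p _; rewrite !scalerA mulrC.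
Qed.

End Theory.

Lemma linear_at0 (U E : lmodType K) (f : U -> E) : linear f -> f 0 = 0.
Proof.
by move=> fl; have := fl (-1) 0 0; rewrite scaleN1r oppr0 add0r scaleN1r addNr.
Qed.

Lemma linear_fsum (E E' : lmodType K) (X : Type) (f : E -> E') L (F : X -> E) :
  linear f -> f (fsum L F) = fsum L (fun x => f (F x)).
Proof.
move=> flin; elim: L => [|[c x] L IHL]; first by rewrite !fsum_nil linear_at0.
by rewrite !fsum_cons flin IHL.
Qed.

End FormalSums.

(** * Cuts, insertions, permutations and unshuffles as signed lists of words *)

Section Words.
Variable K : fieldType.

(** The sign for exchanging two blocks of total degrees p and q. *)
Definition ksg (p q : int) : K := (-1) ^ (p * q).

Lemma ksgC p q : ksg p q = ksg q p.
Proof. by rewrite /ksg mulrC. Qed.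

Lemma ksgDr p q r : ksg p (q + r) = ksg p q * ksg p r.
Proof. by rewrite /ksg mulrDr expfzDr // oppr_eq0 oner_eq0. Qed.

Lemma ksgDl p q r : ksg (p + q) r = ksg p r * ksg q r.
Proof. by rewrite ksgC ksgDr !(ksgC r). Qed.

Lemma ksg0r p : ksg p 0 = 1.
Proof. by rewrite /ksg mulr0. Qed.

Lemma ksgK p q : ksg p q * ksg p q = 1.
Proof.
by rewrite /ksg -expfzMl mulrNN mulr1 exp1rz.
Qed.

Variable V : gvect K.
Notation word := (seq (helt V)).

Lemma degs_nil : degs ([::] : word) = 0.
Proof. by rewrite /degs big_nil. Qed.

Lemma degs_cons (x : helt V) (v : word) : degs (x :: v) = deg x + degs v.
Proof. by rewrite /degs big_cons. Qed.

Lemma degs_cat (u v : word) : degs (u ++ v) = degs u + degs v.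
Proof. by rewrite /degs big_cat. Qed.

Fixpoint splits (v : word) : seq (K * (word * word)) :=
  if v is x :: w then
    (1, ([::], v)) :: fbind (splits w) (fun p => [:: (1, (x :: p.1, p.2))])
  else [:: (1, ([::], [::]))].

(** The sign is that of x moving from the front past the letters of [p.1]. *)
Definition ins (x : helt V) (w : word) : seq (K * word) :=
  fbind (splits w)
    (fun p => [:: (ksg (deg x) (degs p.1), p.1 ++ x :: p.2)]).

(** Equal letters are not identified, so there is one entry for each permutation. *)
Fixpoint syms (v : word) : seq (K * word) :=
  if v is x :: w then fbind (syms w) (ins x) else [:: (1, [::])].

(** A letter sent to the second part passes exactly those later letters that went to the first
    part. *)
Fixpoint unsh (v : word) : seq (K * (word * word)) :=
  if v is x :: w then
    fbind (unsh w) (fun p => [:: (1, (x :: p.1, p.2));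
                                 (ksg (deg x) (degs p.1), (p.1, x :: p.2))])
  else [:: (1, ([::], [::]))].

Section Values.
Variable E : lmodType K.

Lemma fsum1 (X : Type) (c : K) (x : X) (F : X -> E) :
  fsum [:: (c, x)] F = c *: F x.
Proof. by rewrite fsum_cons fsum_nil addr0. Qed.

Lemma splits_nil (H : word * word -> E) : fsum (splits [::]) H = H ([::], [::]).
Proof. by rewrite fsum1 scale1r. Qed.

Lemma splits_cons x w (H : word * word -> E) :
  fsum (splits (x :: w)) H =
  H ([::], x :: w) + fsum (splits w) (fun p => H (x :: p.1, p.2)).
Proof.
rewrite fsum_cons scale1r fsum_bind; congr (_ + _).
by apply: eq_fsum => p; rewrite fsum1 scale1r.
Qed.

Lemma insE x w (F : word -> E) :
  fsum (ins x w) F =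
  fsum (splits w) (fun p => ksg (deg x) (degs p.1) *: F (p.1 ++ x :: p.2)).
Proof. by rewrite fsum_bind; apply: eq_fsum => p; rewrite fsum1. Qed.

Lemma ins_nil x (F : word -> E) : fsum (ins x [::]) F = F [:: x].
Proof. by rewrite insE splits_nil /= degs_nil ksg0r scale1r. Qed.

Lemma ins_cons x y w (F : word -> E) :
  fsum (ins x (y :: w)) F =
  F [:: x, y & w] +
  ksg (deg x) (deg y) *: fsum (ins x w) (fun u => F (y :: u)).
Proof.
rewrite !insE splits_cons /= degs_nil ksg0r scale1r -fsumZ; congr (_ + _).
by apply: eq_fsum => p /=; rewrite degs_cons ksgDr scalerA.
Qed.

Lemma syms_nil (F : word -> E) : fsum (syms [::]) F = F [::].
Proof. by rewrite fsum1 scale1r. Qed.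

Lemma syms_cons x w (F : word -> E) :
  fsum (syms (x :: w)) F = fsum (syms w) (fun u => fsum (ins x u) F).
Proof. by rewrite fsum_bind. Qed.

Lemma unsh_nil (H : word * word -> E) : fsum (unsh [::]) H = H ([::], [::]).
Proof. by rewrite fsum1 scale1r. Qed.

Lemma unsh_cons x w (H : word * word -> E) :
  fsum (unsh (x :: w)) H =
  fsum (unsh w) (fun p => H (x :: p.1, p.2) +
    ksg (deg x) (degs p.1) *: H (p.1, x :: p.2)).
Proof.
rewrite fsum_bind; apply: eq_fsum => p.
by rewrite fsum_cons fsum1 scale1r.
Qed.

Lemma eq_ins x w (F G : word -> E) :
  (forall u, size u = (size w).+1 -> degs u = deg x + degs w -> F u = G u) ->
  fsum (ins x w) F = fsum (ins x w) G.
Proof.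
elim: w F G => [|y w IHw] F G FG.
  by rewrite !ins_nil; apply: FG; rewrite ?degs_cons.
rewrite !ins_cons (FG [:: x, y & w]) ?degs_cons //; congr (_ + _ *: _).
apply: IHw => u su du; apply: FG; rewrite /= ?su //.
by rewrite !degs_cons du addrCA.
Qed.

(** Permuted words keep their length and total degree, the only data that the signs and the degrees
    of values depend on. *)
Lemma eq_syms v (F G : word -> E) :
  (forall w, size w = size v -> degs w = degs v -> F w = G w) ->
  fsum (syms v) F = fsum (syms v) G.
Proof.
elim: v F G => [|x v IHv] F G FG; first by rewrite !syms_nil; apply: FG.
rewrite !syms_cons; apply: IHv => w sw dw; apply: eq_ins => u su du.
by apply: FG; rewrite ?su ?sw // du dw degs_cons.
Qed.

Lemma eq_unsh v (F G : word * word -> E) :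
  (forall a b, (size a + size b)%N = size v -> F (a, b) = G (a, b)) ->
  fsum (unsh v) F = fsum (unsh v) G.
Proof.
elim: v F G => [|x v IHv] F G FG; first by rewrite !unsh_nil; apply: FG.
rewrite !unsh_cons; apply: IHv => a b sab /=.
by rewrite !FG //= ?addnS ?addSn sab.
Qed.

(** Both orders of insertion give the same words, and only the relative sign of x and y changes. The
    graded symmetry of [Psi f] comes from here. *)
Lemma ins_comm x y w (F : word -> E) :
  fsum (ins y w) (fun u => fsum (ins x u) F) =
  ksg (deg x) (deg y) *: fsum (ins x w) (fun u => fsum (ins y u) F).
Proof.
elim: w F => [|z w IHw] F.
  rewrite !(ins_nil, ins_cons) scalerDr scalerA [ksg (deg y) _]ksgC ksgK scale1r.
  by rewrite addrC.
have insz a b : fsum (ins a w) (fun u => fsum (ins b (z :: u)) F) =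
    fsum (ins a w) (fun u => F [:: b, z & u]) + ksg (deg b) (deg z) *:
    fsum (ins a w) (fun u => fsum (ins b u) (fun u' => F (z :: u'))).
  by under eq_fsum => u do rewrite ins_cons; rewrite fsumD fsumZ.
rewrite !ins_cons !insz IHw !scalerDr !scalerA [ksg (deg y) (deg x)]ksgC.
rewrite !ksgK !mul1r !scale1r addrACA [in RHS](addrC (_ *: F _)) -!addrA.
congr (_ + (_ + (_ + (_ + _ *: _)))).
by rewrite mulrC [ksg (deg y) _ * _]mulrC mulrA.
Qed.

(** The cut falls after x or before it; in the second case x has also passed the whole left part. *)
Lemma ins_splits x w (H : word * word -> E) :
  fsum (ins x w) (fun u => fsum (splits u) H) =
  fsum (splits w) (fun p => fsum (ins x p.1) (fun a => H (a, p.2)) +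
    ksg (deg x) (degs p.1) *: fsum (ins x p.2) (fun b => H (p.1, b))).
Proof.
elim: w H => [|y w IHw] H.
  rewrite splits_nil !ins_nil splits_cons splits_nil /= degs_nil ksg0r scale1r.
  by rewrite addrC.
have ins_y : fsum (ins x w) (fun u => fsum (splits (y :: u)) H) =
    fsum (ins x w) (fun u => H ([::], y :: u)) +
    fsum (ins x w) (fun u => fsum (splits u) (fun p => H (y :: p.1, p.2))).
  by under eq_fsum => u do rewrite splits_cons; rewrite fsumD.
have split_y : fsum (splits w) (fun p =>
      fsum (ins x (y :: p.1)) (fun a => H (a, p.2)) +
      ksg (deg x) (degs (y :: p.1)) *:
        fsum (ins x p.2) (fun b => H (y :: p.1, b))) =
    fsum (splits w) (fun p => H ([:: x, y & p.1], p.2)) +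
    ksg (deg x) (deg y) *: fsum (splits w) (fun p =>
      fsum (ins x p.1) (fun a => H (y :: a, p.2)) +
      ksg (deg x) (degs p.1) *: fsum (ins x p.2) (fun b => H (y :: p.1, b))).
  rewrite -fsumZ -fsumD; apply: eq_fsum => p.
  by rewrite ins_cons degs_cons ksgDr scalerDr scalerA addrA.
rewrite ins_cons ins_y IHw 3!splits_cons /= split_y ins_nil degs_nil ksg0r.
rewrite ins_cons scale1r scalerDr -!addrA [LHS]addrCA; congr (_ + (_ + _)).
by rewrite addrCA.
Qed.

(* Both sides sum over the ways c ++ a ++ d of cutting a permuted word in three;
   on the right the letters of [a] are chosen first. *)
Lemma syms_splits v (H : word -> word -> word -> E) :
  fsum (syms v) (fun w => fsum (splits w) (fun p =>
    fsum (splits p.2) (fun q => H p.1 q.1 q.2))) =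
  fsum (unsh v) (fun r => fsum (syms r.1) (fun a => fsum (syms r.2) (fun b =>
    fsum (splits b) (fun p => ksg (degs a) (degs p.1) *: H p.1 a p.2)))).
Proof.
elim: v H => [|x v IHv] H.
  by rewrite syms_nil unsh_nil !(syms_nil, splits_nil) /= degs_nil ksg0r scale1r.
rewrite syms_cons unsh_cons.
under eq_fsum => w do rewrite ins_splits /=.
under eq_fsum => w.
  under eq_fsum => p.
    rewrite ins_splits exchange_fsum -fsumZ -fsumD.
    over.
  over.
(* The first letter lands in c, in a or in d, with the sign of the blocks it jumps over; the
   induction hypothesis is applied to the sum of these three cases. *)
rewrite (IHv (fun c a d => fsum (ins x c) (fun u => H u a d) +
   ksg (deg x) (degs c) *: (fsum (ins x a) (fun u => H c u d) +
   ksg (deg x) (degs a) *: fsum (ins x d) (fun u => H c a u)))).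
apply: eq_fsum => -[a0 b0] /=; rewrite syms_cons -fsumZ -fsumD.
apply: eq_syms => a sa da.
rewrite exchange_fsum syms_cons -fsumZ -fsumD; apply: eq_fsum => b /=.
rewrite exchange_fsum ins_splits -fsumZ -fsumD; apply: eq_fsum => -[c d] /=.
have -> : fsum (ins x a) (fun u => ksg (degs u) (degs c) *: H c u d) =
    fsum (ins x a) (fun u => ksg (deg x + degs a) (degs c) *: H c u d).
  by apply: eq_ins => u _ ->.
have -> : fsum (ins x c) (fun u => ksg (degs a) (degs u) *: H u a d) =
    fsum (ins x c) (fun u => ksg (degs a) (deg x + degs c) *: H u a d).
  by apply: eq_ins => u _ ->.
rewrite !fsumZ -da !(ksgDl, ksgDr) !scalerDr !scalerA addrCA addrA.
(* A letter x placed in c passes a twice, once in the unshuffle and once when c is moved in front of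
   a, and the two signs cancel. *)
rewrite [ksg (degs a) (deg x)]ksgC !mulrA ksgK mul1r [_ * ksg (deg x) _]mulrC.
rewrite -addrA; congr (_ + (_ + _ *: _)).
by rewrite [LHS]mulrC; rewrite mulrA.
Qed.
End Values.
End Words.

(** * Permutations decomposed by the place of the first letter *)

Section LiftPerm.

(** [lift_perm i ord0 t] puts the first letter at place i of the permuted word and orders the others
    by t: this is the insertion step of [syms]. Injectivity suffices, the cardinals being equal. *)
Lemma lift_perm_bij n :
  bijective (fun p : 'I_n.+1 * 'S_n => lift_perm p.1 ord0 p.2).
Proof.
apply: inj_card_bij => [[i s] [j t] /= est|]; last first.
  by rewrite card_prod card_ord !card_Sn factS.
have eij : i = j.
  by apply: (@perm_inj _ (lift_perm i ord0 s)); rewrite {2}est !lift_perm_id.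
rewrite -eij in est *; congr (_, _); apply/permP => k.
by apply: (@lift_inj _ ord0); rewrite -!(lift_perm_lift i) est.
Qed.

Lemma sum_lift_perm (E : nmodType) n (P : pred 'S_n.+1) (F : 'S_n.+1 -> E) :
  \sum_(s | P s) F s =
  \sum_(i < n.+1) \sum_(t : 'S_n | P (lift_perm i ord0 t))
    F (lift_perm i ord0 t).
Proof.
rewrite (reindex _ (onW_bij _ (lift_perm_bij n))).
by rewrite (pair_big_dep xpredT (fun i t => P (lift_perm i ord0 t))).
Qed.

Lemma lift_perm_exists n (s : 'S_n.+1) :
  exists i t, s = lift_perm i ord0 t.
Proof.
have [g _ gK] := lift_perm_bij n.
by exists (g s).1, (g s).2; rewrite [RHS]gK.
Qed.

(** Both blocks of a shuffle increase, so the smallest letter heads one of them, at place 0 or l.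
    For [l = 0] these places coincide, and [l.-1 = 0] is again the right type. *)
Lemma is_shuffle_lift n l (i : 'I_n.+1) (t : 'S_n) :
  is_shuffle l (lift_perm i ord0 t) =
  if i == 0 :> nat then is_shuffle l.-1 t else (i == l :> nat) && is_shuffle l t.
Proof.
have shP m k (s : 'S_m) : reflect (forall a b : 'I_m, (a < b)%N ->
    (b < k)%N || (k <= a)%N -> (s a < s b)%N) (is_shuffle k s).
  apply: (iffP forallP) => [sh a b ab kab | sh a].
    by have /forallP/(_ b) := sh a; rewrite ab kab.
  by apply/forallP => b; apply/implyP => /andP[]; apply: sh.
have lt_bump a b : (bump i a < bump i b)%N = (a < b)%N by rewrite /bump; lia.
have lt_lift (a b : 'I_n) :
    (lift ord0 (t a) < lift ord0 (t b))%N = (t a < t b)%N.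
  by rewrite /= /bump; lia.
case: eqP => [i0 | /eqP i0]; [|have [il | nil] := eqVneq (i : nat) l].
- apply/shP/shP => sh a b ab lab.
    rewrite -lt_lift -!(lift_perm_lift i); apply: sh.
      by rewrite lt_bump.
    by move: lab; rewrite /= /bump i0; lia.
  case: (unliftP i a) => [a'|] ea; case: (unliftP i b) => [b'|] eb.
  - rewrite ea eb !lift_perm_lift lt_lift.
    move: ab lab; rewrite ea eb /= lt_bump /bump i0 => ab lab.
    by apply: sh => //; lia.
  - by move: ab; rewrite eb i0.
  - by rewrite ea eb lift_perm_id lift_perm_lift.
  - by move: ab; rewrite ea eb ltnn.
- apply/shP/shP => sh a b ab lab.
    rewrite -lt_lift -!(lift_perm_lift i); apply: sh.
      by rewrite lt_bump.
    by move: lab; rewrite /= /bump il; lia.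
  case: (unliftP i a) => [a'|] ea; case: (unliftP i b) => [b'|] eb.
  - rewrite ea eb !lift_perm_lift lt_lift.
    move: ab lab; rewrite ea eb /= lt_bump /bump il => ab lab.
    by apply: sh => //; lia.
  - by move: ab lab; rewrite eb; lia.
  - by rewrite ea eb lift_perm_id lift_perm_lift.
  - by move: ab; rewrite ea eb ltnn.
(* At any other place the smallest letter would follow the head of its own block, which sits at
   place 0 or l. *)
- apply/shP => sh; have [il | li] := ltnP i l.
    by have := sh ord0 i; rewrite lift_perm_id ltn0 il lt0n => /(_ i0 isT).
  have ln : (l < n.+1)%N by apply: leq_ltn_trans li _.
  have := sh (Ordinal ln) i; rewrite lift_perm_id ltn0 /= leqnn orbT.
  by rewrite ltn_neqAle eq_sym nil li => /(_ isT isT).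
Qed.

End LiftPerm.

(** * Sums over permutations and shuffles as sums over the recursive lists *)

Section Permw.
Variables (K : fieldType) (V : gvect K).
Notation word := (seq (helt V)).

Lemma size_permw (v : word) (s : 'S_(size v)) : size (permw s : word) = size v.
Proof. by rewrite size_map size_enum_ord. Qed.

Lemma nth_permw x0 (v : word) (s : 'S_(size v)) (j : 'I_(size v)) :
  nth x0 (permw s) j = nth x0 v (s j).
Proof.
by rewrite (nth_map j) ?size_enum_ord // nth_ord_enum (tnth_nth x0).
Qed.

Lemma koszulE x0 (v : word) (s : 'S_(size v)) :
  koszul s = \prod_(i < size v) \prod_(j < size v | (i < j)%N && (s j < s i)%N)
    ksg K (deg (nth x0 (permw s) i)) (deg (nth x0 (permw s) j)).
Proof.
apply: eq_bigr => i _; apply: eq_bigr => j _.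
by rewrite !nth_permw !(tnth_nth x0).
Qed.

Lemma permw_nil (s : 'S_0) : @permw K V [::] s = [::].
Proof. exact/size0nil/size_permw. Qed.

Lemma koszul_nil (s : 'S_0) : @koszul K V [::] s = 1.
Proof. by rewrite /koszul big_ord0. Qed.

Lemma permw_lift x (v : word) (i : 'I_(size v).+1) (t : 'S_(size v)) :
  @permw K V (x :: v) (lift_perm i ord0 t) =
  take i (permw t) ++ x :: drop i (permw t).
Proof.
have sz : size (take i (permw t) ++ x :: drop i (permw t)) = (size v).+1.
  by rewrite -cat_rcons -cats1 -catA !size_cat addnCA -size_cat cat_take_drop
    size_permw.
apply: (@eq_from_nth _ x); rewrite ?sz ?size_permw // => j jlt.
have sti : size (take i (permw t)) = i.
  by rewrite size_takel // size_permw -ltnS.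
rewrite (@nth_permw x (x :: v) _ (Ordinal jlt)) nth_cat sti.
case: (unliftP i (Ordinal jlt)) => [k|] ej; last first.
  by rewrite ej lift_perm_id -[j]/(val (Ordinal jlt)) ej ltnn subnn.
rewrite ej lift_perm_lift -[j]/(val (Ordinal jlt)) ej /= -nth_permw /bump.
case: (leqP i k) => ik; rewrite ?add1n ?add0n.
  by rewrite ltnNge ltnW // subSn //= nth_drop subnKC.
by rewrite ik nth_take.
Qed.

(* The letter x = v_0 is put at position i: it inverts with the i letters before
   it. *)
Lemma koszul_lift x (v : word) (i : 'I_(size v).+1) (t : 'S_(size v)) :
  @koszul K V (x :: v) (lift_perm i ord0 t) =
  koszul t * ksg K (deg x) (degs (take i (permw t))).
Proof.
have nthi : nth x (@permw K V (x :: v) (lift_perm i ord0 t)) i = x.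
  by rewrite nth_permw lift_perm_id.
have nthl (k : 'I_(size v)) :
    nth x (@permw K V (x :: v) (lift_perm i ord0 t)) (lift i k) =
    nth x (permw t) k.
  by rewrite !nth_permw lift_perm_lift.
(* Row i of the product is empty, as nothing lies below [ord0]; every other row k gains the factor
   of column i exactly when [k < i]. *)
rewrite (koszulE x) (bigD1_ord i) //= big1 ?mul1r; last first.
  by move=> j; rewrite lift_perm_id ltn0 andbF.
rewrite (koszulE x).
have -> : ksg K (deg x) (degs (take i (permw t))) =
    \prod_(k < size v) if (k < i)%N then
      ksg K (deg (nth x (permw t) k)) (deg x) else 1.
  have: (i <= size v)%N by rewrite -ltnS.
  rewrite -big_mkcond /=; elim: {nthi nthl}(i : nat) => [|m IHm] ms.
    by rewrite take0 degs_nil ksg0r big_pred0.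
  rewrite (take_nth x) ?size_permw // -cats1 degs_cat degs_cons degs_nil addr0.
  rewrite ksgDr IHm 1?ltnW // [RHS](bigD1 (Ordinal ms)) //= mulrC ksgC.
  congr (_ * _); apply: eq_bigl => k; rewrite -val_eqE /=; lia.
rewrite -big_split /=; apply: eq_bigr => k _.
rewrite big_mkcond (bigD1_ord i) //= -big_mkcond /= nthl nthi mulrC.
rewrite lift_perm_id lift_perm_lift andbT; congr (_ * _).
  apply: eq_big => [m|m _]; last by rewrite nthl.
  by rewrite !lift_perm_lift /= /bump; lia.
by rewrite /= /bump; congr (if _ then _ else _); lia.
Qed.

Variable E : lmodType K.

Lemma splits_take_drop (v : word) (H : word * word -> E) :
  fsum (splits v) H = \sum_(i < (size v).+1) H (take i v, drop i v).
Proof.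
elim: v H => [|x v IHv] H; first by rewrite splits_nil big_ord1.
by rewrite splits_cons big_ord_recl IHv.
Qed.

Lemma sum_koszul (v : word) (F : word -> E) :
  \sum_(s : 'S_(size v)) koszul s *: F (permw s) = fsum (syms v) F.
Proof.
elim: v F => [|x v IHv] F.
  rewrite syms_nil (big_pred1 1%g) => [|s]; last first.
    by apply/esym/eqP/permP => -[].
  by rewrite permw_nil koszul_nil scale1r.
rewrite syms_cons -IHv /= sum_lift_perm exchange_big.
apply: eq_bigr => t _; rewrite insE splits_take_drop size_permw scaler_sumr.
by apply: eq_bigr => i _; rewrite koszul_lift permw_lift scalerA.
Qed.

(** The list [unsh] contains unshuffles of all types, hence the test on the size. The bound on l
    matters: beyond the length of v the identity still counts as a shuffle. *)
Lemma sum_shuffles l (v : word) (F : word -> E) : (l <= size v)%N ->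
  \sum_(s : 'S_(size v) | is_shuffle l s) koszul s *: F (permw s) =
  fsum (unsh v) (fun p => if size p.1 == l then F (p.1 ++ p.2) else 0).
Proof.
elim: v l F => [|x v IHv] l F.
  rewrite leqn0 => /eqP ->.
  rewrite unsh_nil big_mkcond (big_pred1 1%g) => [|s]; last first.
    by apply/esym/eqP/permP => -[].
  rewrite permw_nil koszul_nil scale1r /=.
  by rewrite (_ : is_shuffle _ _ = true) //; apply/forallP => -[].
move=> lv; rewrite unsh_cons /= sum_lift_perm big_ord_recl /=.
have -> : \sum_(t : 'S_(size v) | is_shuffle l (lift_perm ord0 ord0 t))
      @koszul K V (x :: v) (lift_perm ord0 ord0 t) *:
      F (@permw K V (x :: v) (lift_perm ord0 ord0 t)) =
    fsum (unsh v) (fun p => if size p.1 == l.-1 then F (x :: p.1 ++ p.2) else 0).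
  rewrite -(IHv _ (fun w => F (x :: w))); last by case: l lv.
  apply: eq_big => [t|t _]; first by rewrite is_shuffle_lift.
  by rewrite koszul_lift permw_lift take0 drop0 degs_nil ksg0r mulr1.
case: l lv => [|l] lv.
  rewrite big1 ?addr0 => [|i _]; last first.
    by rewrite big_pred0 // => t; rewrite is_shuffle_lift.
  apply: eq_fsum => -[[|y a] b] /=; last by rewrite scaler0 addr0.
  by rewrite degs_nil ksg0r scale1r add0r.
rewrite fsumD; congr (_ + _).
(* The index i now stands for the place [i.+1], so x heads the second block, at place [l.+1], only
   for [i = l]. *)
transitivity (\sum_(i < size v | i == l :> nat)
    \sum_(t : 'S_(size v) | is_shuffle l.+1 t)
    koszul t *: (ksg K (deg x) (degs (take l.+1 (permw t))) *:
      F (take l.+1 (permw t) ++ x :: drop l.+1 (permw t)))).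
  rewrite [RHS]big_mkcond; apply: eq_bigr => i _.
  rewrite (eq_bigl _ _ (fun t => is_shuffle_lift _ _ _)) /= eqSS.
  case: eqP => [il|_]; last by rewrite big_pred0.
  apply: eq_bigr => t _.
  by rewrite koszul_lift permw_lift scalerA /= /bump /= add1n il.
(* If [l = size v], the first block takes every letter and x cannot head the second: both sides
   vanish. *)
have [lv'|vl] := ltnP l (size v); last first.
  rewrite big_pred0 => [|i]; last by apply/negbTE; move: (ltn_ord i); lia.
  rewrite -[LHS](fsum0 _ (unsh v)); apply: eq_unsh => a b sab /=.
  by rewrite ifN ?scaler0 //; lia.
rewrite (big_pred1 (Ordinal lv')) => [|i]; last by rewrite /= -val_eqE.
rewrite (IHv _ (fun w => ksg K (deg x) (degs (take l.+1 w)) *: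
   F (take l.+1 w ++ x :: drop l.+1 w))) //.
apply: eq_fsum => -[a b] /=; case: eqP => [<-|_]; last by rewrite scaler0.
by rewrite take_size_cat // drop_size_cat.
Qed.

(** Only adjacent exchanges are required, which avoids permutations; [gsym_koszul] recovers the
    general case. *)
Definition gsym (F : word -> E) : Prop := forall u x y w,
  F (u ++ x :: y :: w) = ksg K (deg x) (deg y) *: F (u ++ y :: x :: w).

Lemma gsym_move F z x u w : gsym F ->
  F (z ++ x :: u ++ w) = ksg K (deg x) (degs u) *: F (z ++ u ++ x :: w).
Proof.
move=> Fsym; elim: u z => [|y u IHu] z; first by rewrite degs_nil ksg0r scale1r.
rewrite /= Fsym -cat_rcons IHu degs_cons ksgDr scalerA.
by rewrite cat_rcons.
Qed.

(** Permute the tail by induction, then carry the first letter to its place. *)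
Lemma gsym_koszul F (v : word) (s : 'S_(size v)) :
  gsym F -> F v = koszul s *: F (permw s).
Proof.
elim: v F s => [|x v IHv] F s Fsym.
  by rewrite permw_nil koszul_nil scale1r.
have [i [t ->]] := lift_perm_exists s.
rewrite koszul_lift permw_lift (IHv (fun w => F (x :: w)) t) => [|u]; last first.
  exact: Fsym (x :: u).
rewrite -scalerA; congr (_ *: _).
by rewrite -{1}(cat_take_drop i (permw t)) (gsym_move [::]).
Qed.

Lemma gsym_syms F : gsym (fun v => fsum (syms v) F).
Proof.
move=> u x y w; elim: u F => [|z u IHu] F; last by rewrite !syms_cons IHu.
by rewrite !cat0s !syms_cons -fsumZ; apply: eq_fsum => v; rewrite ins_comm.
Qed.

End Permw.

Lemma PsiE (K : fieldType) (V W : gvect K) (f : mmap V W) v e :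
  Psi f v e = fsum (syms v) (fun w => f w e).
Proof. exact: (sum_koszul v (f^~ e)). Qed.

(** * Multilinearity of the sums over cuts, insertions and permutations *)

Section Linear.
Variables (K : fieldType) (U E : lmodType K).

Lemma linear_addf (f g : U -> E) :
  linear f -> linear g -> linear (fun x => f x + g x).
Proof. by move=> fl gl c x y; rewrite fl gl scalerDr addrACA. Qed.

End Linear.

Section Multilinear.
Variables (K : fieldType) (V : gvect K) (E : lmodType K).
Notation word := (seq (helt V)).
Implicit Types (F : word -> E) (H : word * word -> E).

Definition mlin F : Prop := forall u w d,
  linear (fun x : V d => F (u ++ helem x :: w)).

Lemma mlin_cons F y : mlin F -> mlin (fun w => F (y :: w)).
Proof. by move=> Fl u; apply: (Fl (y :: u)). Qed.

(** The total degree does not change when a letter varies within its degree, so a sign depending on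
    it acts as a constant. *)
Lemma mlin_scale_degs F (c : int -> K) :
  mlin F -> mlin (fun w => c (degs w) *: F w).
Proof.
move=> Fl u w d a x y; rewrite !degs_cat !degs_cons /= Fl.
by rewrite scalerDr !scalerA mulrC.
Qed.

Lemma mlin_catl F w : mlin F -> mlin (fun u => F (u ++ w)).
Proof. by move=> Fl u w' d a x y; rewrite -!catA !cat_cons Fl. Qed.

Lemma mlin_catr F u : mlin F -> mlin (fun w => F (u ++ w)).
Proof. by move=> Fl u' w d a x y; rewrite !catA Fl. Qed.

Lemma mlin_splits H :
  (forall b, mlin (fun a => H (a, b))) -> (forall a, mlin (fun b => H (a, b))) ->
  mlin (fun v => fsum (splits v) H).
Proof.
move=> Hl Hr u w d; elim: u H Hl Hr => [|z u IHu] H Hl Hr a x y.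
  rewrite !cat0s !splits_cons (Hr [::] [::]) scalerDr -!addrA; congr (_ + _).
  rewrite [RHS]addrCA -fsumZ -fsumD; congr (_ + _); apply: eq_fsum => p.
  exact: (Hl _ [::]).
rewrite !cat_cons !splits_cons (mlin_cons z (Hr [::])) IHu.
- by rewrite scalerDr addrACA.
- by move=> b; exact: (mlin_cons z (Hl b)).
- by move=> b; exact: (Hr (z :: b)).
Qed.

Lemma linear_ins F w d :
  mlin F -> linear (fun x : V d => fsum (ins (helem x) w) F).
Proof.
move=> Fl a x y; rewrite !insE -fsumZ -fsumD; apply: eq_fsum => p.
by rewrite Fl scalerDr !scalerA mulrC.
Qed.

Lemma mlin_ins F x : mlin F -> mlin (fun w => fsum (ins x w) F).
Proof.
move=> Fl u w d a y z; rewrite !insE; move: a y z.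
apply: (@mlin_splits (fun p => ksg K (deg x) (degs p.1) *: F (p.1 ++ x :: p.2))).
  by move=> b; exact: (mlin_scale_degs (ksg K (deg x)) (mlin_catl (x :: b) Fl)).
move=> b u' w' d' a y z /=; rewrite -cat_rcons.
rewrite (mlin_catr (rcons b x) Fl) scalerDr !scalerA mulrC.
by rewrite !cat_rcons.
Qed.

Lemma mlin_syms F : mlin F -> mlin (fun v => fsum (syms v) F).
Proof.
move=> Fl u w d; elim: u F Fl => [|z u IHu] F Fl a x y.
  rewrite !cat0s !syms_cons -fsumZ -fsumD; apply: eq_fsum => v.
  exact: linear_ins.
by rewrite !cat_cons !syms_cons IHu //; apply: mlin_ins.
Qed.

End Multilinear.

(** * Compatibility of [Psi] with the brackets *)

Section Circ.
Variables (K : fieldType) (V : gvect K).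
Notation word := (seq (helt V)).

(** The degree is a type index, so an equal expression for it has to be substituted here rather than
    rewritten in place. *)
Lemma hvalE (W : gvect K) n (g : mmap V W) v d :
  d = n + degs v -> hval n g v = helem (g v d).
Proof. by move->. Qed.

Lemma multilinearP (W : gvect K) (f : mmap V W) :
  multilinear f <-> forall e, mlin (f^~ e).
Proof. by split=> [fl e u w d | fl u w d e]; apply: fl. Qed.

Implicit Types f g : mmap V V.

(** The block position [(i, l)] becomes two successive cuts; the test discards the empty block, as
    arities start at 1. *)
Lemma circTE n f g v e :
  circT n f g v e =
  fsum (splits v) (fun p => fsum (splits p.2) (fun q =>
    if size q.1 == 0 then 0
    else ksg K n (degs p.1) *: f (p.1 ++ hval n g q.1 :: q.2) e)).
Proof.
rewrite splits_take_drop /circT.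
pose X i l := ksg K n (degs (take i v)) *:
  f (take i v ++ hval n g (take l (drop i v)) :: drop (i + l) v) e.
(* The triangular range is embedded in a square, with the constraint moved into the summand, so that
   the two sums can be exchanged. *)
transitivity (\sum_(0 <= i < (size v).+1) \sum_(0 <= l < (size v).+1)
    if (0 < l)%N && (i + l <= size v)%N then X i l else 0).
  rewrite exchange_big /= [RHS]big_ltn // [X in X + _]big1 ?add0r //.
  apply: eq_big_nat => l /andP[l0 lv].
  rewrite (big_nat_widen _ _ (size v).+1); last lia.
  rewrite big_mkcond; apply: eq_big_nat => i /andP[_ iv].
  by rewrite /= l0; congr (if _ then _ else _); lia.
rewrite big_mkord; apply: eq_bigr => i _; rewrite splits_take_drop size_drop.
rewrite -(big_mkord xpredT (fun j => if size (take j (drop i v)) == 0 then 0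
  else ksg K n (degs (take i v)) *:
    f (take i v ++ hval n g (take j (drop i v)) :: drop j (drop i v)) e)).
rewrite [RHS](big_nat_widen _ _ (size v).+1); last lia.
rewrite [RHS]big_mkcond; apply: eq_big_nat => l /andP[_ lv] /=.
move: (nat_of_ord i) (ltn_ord i) => {}i iv; rewrite drop_drop addnC.
case: (leqP (l + i) (size v)) => liv; last by rewrite andbF ifN //; lia.
rewrite andbT [RHS]ifT; last lia.
rewrite size_takel ?size_drop; last lia.
by rewrite lt0n; case: eqP => //= _; rewrite addnC.
Qed.

Lemma circSE n f g v e :
  circS n f g v e =
  fsum (unsh v) (fun p =>
    if size p.1 == 0 then 0 else f (hval n g p.1 :: p.2) e).
Proof.
transitivity (\sum_(1 <= l < (size v).+1) fsum (unsh v) (fun p =>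
    if size p.1 == l then f (hval n g p.1 :: p.2) e else 0)).
  apply: eq_big_nat => l /andP[_ lv].
  rewrite (@sum_shuffles _ _ _ l v
    (fun w => f (hval n g (take l w) :: drop l w) e)) //.
  apply: eq_fsum => -[a b] /=; case: eqP => // <-.
  by rewrite take_size_cat // drop_size_cat.
rewrite -fsum_sum; apply: eq_unsh => a b sab /=; rewrite -big_mkcond /=.
rewrite (eq_bigl (fun l => l == size a)) => [|l]; last by rewrite eq_sym.
rewrite big_nat1_eq lt0n ltnS; case: eqP => //= _.
by rewrite ifT //; lia.
Qed.

Lemma multilinear_circT n f g :
  multilinear f -> multilinear g -> multilinear (circT n f g).
Proof.
move=> fl gl; apply/multilinearP => e u w d a x y; rewrite !circTE; move: a x y.
apply: (@mlin_splits _ _ _ (fun p => fsum (splits p.2) (fun q =>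
    if size q.1 == 0 then 0
    else ksg K n (degs p.1) *: f (p.1 ++ hval n g q.1 :: q.2) e))) => [b|c] /=.
  move=> {}u {}w {}d a x y; rewrite -fsumZ -fsumD; apply: eq_fsum => q.
  case: ifP => _; first by rewrite scaler0 addr0.
  apply: (mlin_scale_degs (ksg K n)
    (F := fun c => f (c ++ hval n g q.1 :: q.2) e)).
  exact/(@mlin_catl _ _ _ (f^~ e))/((multilinearP f).1 fl e).
apply: (@mlin_splits _ _ _ (fun q => if size q.1 == 0 then 0
    else ksg K n (degs c) *: f (c ++ hval n g q.1 :: q.2) e)) => [d'|a'] /=.
  move=> {}u {}w {}d a x y; rewrite !size_cat /= !addnS /=.
  (* The degree is expressed without z, so that the values at x, y and their combination lie in the
     same component. *)
  have hg (z : V d) : hval n g (u ++ helem z :: w) =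
      helem (g (u ++ helem z :: w) (n + (degs u + (d + degs w)))).
    by apply: hvalE; rewrite degs_cat degs_cons.
  by rewrite !hg gl fl scalerDr !scalerA mulrC.
move=> {}u {}w {}d a x y; case: ifP => _; first by rewrite scaler0 addr0.
rewrite -!(cat_rcons (hval n g a') c) !catA.
rewrite (fl (rcons c (hval n g a') ++ u)) scalerDr !scalerA.
by rewrite [a * _]mulrC.
Qed.

Lemma multilinear_brT m n f g :
  multilinear f -> multilinear g -> multilinear (brT m n f g).
Proof.
move=> fl gl u w d e; rewrite /brT => a x y.
rewrite !multilinear_circT // scalerBr scalerDr !scalerA mulrC.
by rewrite opprD addrACA.
Qed.

(** Inserting the value of g into an ordering b of the other letters amounts to a cut of b into c
    and d, and linearity of f extracts the sum over orderings of the block a. This is the right side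
    of [syms_splits]. *)
Lemma circS_Psi n f g v e :
  multilinear f -> circS n (Psi f) (Psi g) v e = Psi (circT n f g) v e.
Proof.
move=> fl; rewrite PsiE circSE.
under [RHS]eq_fsum => w do rewrite circTE.
rewrite (@syms_splits _ _ _ v (fun c a d => if size a == 0 then 0
    else ksg K n (degs c) *: f (c ++ hval n g a :: d) e)).
apply: eq_fsum => -[a0 b0] /=; case: eqP => [a00|/eqP a00].
  rewrite -[LHS](fsum0 _ (syms a0)); apply: eq_syms => a sa _.
  rewrite sa a00 -[LHS](fsum0 _ (syms b0)); apply: eq_fsum => b.
  by rewrite -[LHS](fsum0 _ (splits b)); apply: eq_fsum => p; rewrite scaler0.
rewrite PsiE syms_cons exchange_fsum; apply: eq_fsum => b.
rewrite insE exchange_fsum; apply: eq_fsum => -[c d] /=.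
rewrite {1}/hval PsiE (linear_fsum (f := fun z => f (c ++ helem z :: d) e));
  last exact: fl.
rewrite -fsumZ; apply: eq_syms => a sa da.
(* The value of g has degree [n + degs a]; its sign against c is the sign of [circT] times the one
   produced by [syms_splits]. *)
rewrite sa (negbTE a00) (@hvalE _ _ _ _ (n + degs a0)) ?da //.
by rewrite ksgDl scalerA mulrC.
Qed.

Lemma brS_Psi m n f g v e : multilinear f -> multilinear g ->
  brS m n (Psi f) (Psi g) v e = Psi (brT m n f g) v e.
Proof.
move=> fl gl; rewrite /brS !circS_Psi // !PsiE /brT.
by rewrite -scaleNr -fsumZ -fsumD; apply: eq_fsum => w; rewrite scaleNr.
Qed.

Definition eqm (W : gvect K) (f g : mmap V W) := forall v e, f v e = g v e.

Lemma eq_brS m n f f' g g' :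
  eqm f f' -> eqm g g' -> eqm (brS m n f g) (brS m n f' g').
Proof.
move=> ff gg v e; rewrite /brS !circSE; congr (_ - _ *: _).
  by apply: eq_fsum => p; rewrite ff /hval gg.
by apply: eq_fsum => p; rewrite gg /hval ff.
Qed.

Lemma multilinear_Psi (W : gvect K) (f : mmap V W) :
  multilinear f -> multilinear (Psi f).
Proof.
move=> /multilinearP fl; apply/multilinearP => e u w d a x y.
by rewrite !PsiE (mlin_syms (fl e)).
Qed.

Lemma HomS_Psi (W : gvect K) n (f : mmap V W) : HomT n f -> HomS n (Psi f).
Proof.
move=> [fl fd]; split; first split; first exact: multilinear_Psi.
  move=> v e v0 ve; rewrite PsiE -[RHS](fsum0 _ (syms v)).
  apply: eq_syms => w sw dw; apply: fd; last by rewrite dw.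
  by rewrite -size_eq0 sw size_eq0.
move=> v s e; rewrite (PsiE _ v) (PsiE _ (permw s)).
exact: (gsym_koszul s (@gsym_syms _ _ _ (f^~ e))).
Qed.

Lemma Linf_Psi (mu : mmap V V) : is_Ainf mu -> is_Linf (Psi mu).
Proof.
move=> [muH mu0]; split; first exact: HomS_Psi.
have [mul _] := muH; move=> v e v0; rewrite brS_Psi // PsiE.
rewrite -[RHS](fsum0 _ (syms v)); apply: eq_syms => w sw _.
by rewrite /brT mu0 ?scaler0 ?subr0 // -size_eq0 sw size_eq0.
Qed.

End Circ.

(** * Words with a distinguished letter *)

Section Pointed.
Variables (K : fieldType) (V : gvect K).
Notation word := (seq (helt V)).

Fixpoint pt (v : word) : seq (K * (word * helt V * word)) :=
  if v is x :: w then
    (1, ([::], x, w)) :: fbind (pt w) (fun t => [:: (1, (x :: t.1.1, t.1.2, t.2))])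
  else [::].

Variable E : lmodType K.
Implicit Types (G : word -> helt V -> word -> E).

Definition psum v G : E := fsum (pt v) (fun t => G t.1.1 t.1.2 t.2).

Lemma psum_nil G : psum [::] G = 0.
Proof. exact: fsum_nil. Qed.

Lemma psum_cons x w G :
  psum (x :: w) G = G [::] x w + psum w (fun a => G (x :: a)).
Proof.
rewrite /psum fsum_cons scale1r fsum_bind; congr (_ + _).
by apply: eq_fsum => p; rewrite fsum1 scale1r.
Qed.

Lemma psum_cat u w G :
  psum (u ++ w) G = psum u (fun a x b => G a x (b ++ w)) +
    psum w (fun a x b => G (u ++ a) x b).
Proof.
elim: u G => [|x u IHu] G; first by rewrite psum_nil add0r.
by rewrite cat_cons !psum_cons IHu addrA.
Qed.

Lemma eq_psum v G G' :
  (forall a x b, v = a ++ x :: b -> G a x b = G' a x b) -> psum v G = psum v G'.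
Proof.
elim: v G G' => [|x v IHv] G G' GG; first by rewrite !psum_nil.
rewrite !psum_cons GG //; congr (_ + _); apply: IHv => a y b vE.
by rewrite GG // vE.
Qed.

Lemma psum_tnth v G :
  \sum_(i < size v) G (take i v) (tnth (in_tuple v) i) (drop i.+1 v) = psum v G.
Proof.
elim: v G => [|x v IHv] G; first by rewrite psum_nil big_ord0.
rewrite psum_cons big_ord_recl /= drop0 -IHv; congr (G _ _ _ + _).
apply: eq_bigr => i _ /=; congr G.
by rewrite !(tnth_nth x).
Qed.

Lemma mlin_psum G :
  (forall y b, mlin (fun a => G a y b)) ->
  (forall a b d, linear (fun x : V d => G a (helem x) b)) ->
  (forall a y, mlin (fun b => G a y b)) -> mlin (fun v => psum v G).
Proof.
move=> Gl Gm Gr u; elim: u G Gl Gm Gr => [|z u IHu] G Gl Gm Gr w d a x y.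
  rewrite !cat0s !psum_cons Gm scalerDr -!addrA; congr (_ + _).
  rewrite [RHS]addrCA /psum -fsumZ -fsumD; congr (_ + _); apply: eq_fsum => p.
  exact: (Gl _ _ [::]).
rewrite !cat_cons !psum_cons Gr IHu.
- by rewrite scalerDr addrACA.
- by move=> y' b; exact: (mlin_cons z (Gl y' b)).
- by move=> a' b d'; exact: Gm.
- by move=> a' y'; exact: Gr.
Qed.

End Pointed.

(** * Degree-preserving maps applied letterwise *)

Section MapWords.
Variables (K : fieldType) (V V' : gvect K) (h : helt V -> helt V').
Hypothesis deg_h : forall x, deg (h x) = deg x.

Lemma degs_map v : degs (map h v) = degs v.
Proof. by elim: v => [|x v IHv]; rewrite ?degs_nil // !degs_cons deg_h IHv. Qed.

Variable E : lmodType K.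

Lemma psum_map v (G : seq (helt V') -> helt V' -> seq (helt V') -> E) :
  psum (map h v) G = psum v (fun a x b => G (map h a) (h x) (map h b)).
Proof.
by elim: v G => [|x v IHv] G; rewrite ?psum_nil // !psum_cons IHv.
Qed.

Lemma splits_map v (H : seq (helt V') * seq (helt V') -> E) :
  fsum (splits (map h v)) H =
  fsum (splits v) (fun p => H (map h p.1, map h p.2)).
Proof.
by elim: v H => [|x v IHv] H; rewrite ?splits_nil // !splits_cons IHv.
Qed.

Lemma ins_map x v (F : seq (helt V') -> E) :
  fsum (ins (h x) (map h v)) F = fsum (ins x v) (fun w => F (map h w)).
Proof.
rewrite !insE splits_map; apply: eq_fsum => p /=.
by rewrite degs_map deg_h map_cat.
Qed.

Lemma syms_map v (F : seq (helt V') -> E) :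
  fsum (syms (map h v)) F = fsum (syms v) (fun w => F (map h w)).
Proof.
elim: v F => [|x v IHv] F; rewrite ?syms_nil // !syms_cons IHv.
by apply: eq_fsum => w; rewrite ins_map.
Qed.

End MapWords.

(** * Components with exactly one letter in M *)

Section Mark.
Variables (K : fieldType) (V : gvect K) (p q : helt V -> helt V).
Hypotheses (deg_p : forall x, deg (p x) = deg x)
  (deg_q : forall x, deg (q x) = deg x).
Notation word := (seq (helt V)).
Variable E : lmodType K.
Implicit Types (F : word -> E) (H : word * word -> E).

(* With p the projection to A and q the projection to M, [mark] lists the
   components of a word of A (+) M with exactly one letter in M. *)
Definition mark F v : E :=
  psum v (fun a x b => F (map p a ++ q x :: map p b)).

Lemma mark_nil F : mark F [::] = 0.
Proof. exact: psum_nil. Qed.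

Lemma mark_cons F x v :
  mark F (x :: v) = F (q x :: map p v) + mark (fun w => F (p x :: w)) v.
Proof. exact: psum_cons. Qed.

Lemma mark_cat F c y d :
  mark F (c ++ y :: d) = mark (fun w => F (w ++ p y :: map p d)) c +
    F (map p c ++ q y :: map p d) +
    mark (fun w => F (map p c ++ p y :: w)) d.
Proof.
rewrite /mark psum_cat psum_cons cats0 !addrA; congr (_ + _ + _).
  by apply: eq_psum => a x b _; rewrite map_cat -catA.
by apply: eq_psum => a x b _; rewrite map_cat -catA.
Qed.

Lemma eq_mark F F' v :
  (forall a x b, v = a ++ x :: b ->
    F (map p a ++ q x :: map p b) = F' (map p a ++ q x :: map p b)) ->
  mark F v = mark F' v.
Proof. exact: eq_psum. Qed.

Lemma degs_mark a x b : degs (map p a ++ q x :: map p b) = degs (a ++ x :: b).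
Proof. by rewrite !degs_cat !degs_cons !degs_map // deg_q. Qed.

Lemma markD F F' v : mark (fun w => F w + F' w) v = mark F v + mark F' v.
Proof. exact: fsumD. Qed.

Lemma markZ c F v : mark (fun w => c *: F w) v = c *: mark F v.
Proof. exact: fsumZ. Qed.

Lemma mark_fsum (X : Type) (L : seq (K * X)) (F : X -> word -> E) v :
  mark (fun w => fsum L (F^~ w)) v = fsum L (fun x => mark (F x) v).
Proof. exact: exchange_fsum. Qed.

(** The letter in M is either the inserted one or a letter of w; the signs agree because p and q
    preserve degrees. *)
Lemma mark_ins x w F :
  fsum (ins x w) (mark F) =
  fsum (ins (q x) (map p w)) F + mark (fun u => fsum (ins (p x) u) F) w.
Proof.
elim: w F => [|y w IHw] F; first by rewrite !ins_nil mark_cons !mark_nil.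
have insy : fsum (ins x w) (fun u => mark F (y :: u)) =
    fsum (ins x w) (fun u => F (q y :: map p u)) +
    fsum (ins x w) (mark (fun u => F (p y :: u))).
  by rewrite -fsumD; apply: eq_fsum => u; rewrite mark_cons.
have marky : mark (fun u => fsum (ins (p x) (p y :: u)) F) w =
    mark (fun u => F [:: p x, p y & u]) w + ksg K (deg x) (deg y) *:
    mark (fun u => fsum (ins (p x) u) (fun u' => F (p y :: u'))) w.
  rewrite -markZ -markD; apply: eq_mark => a z b _.
  by rewrite ins_cons !deg_p.
rewrite ins_cons insy IHw !mark_cons marky [map p _]/= !ins_cons.
rewrite (ins_map deg_p _ _ (fun u => F (q y :: u))) !deg_p !deg_q !scalerDr.
rewrite -!addrA; congr (_ + _); rewrite [RHS]addrCA; congr (_ + _).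
by rewrite [LHS]addrCA [RHS]addrCA; congr (_ + _); exact: addrCA.
Qed.

Lemma mark_syms v F :
  mark (fun w => fsum (syms w) F) v = fsum (syms v) (mark F).
Proof.
elim: v F => [|x v IHv] F; first by rewrite syms_nil !mark_nil.
rewrite mark_cons syms_cons.
have -> : mark (fun w => fsum (syms (p x :: w)) F) v =
    mark (fun w => fsum (syms w) (fun u => fsum (ins (p x) u) F)) v.
  by apply: eq_mark => a y b _; rewrite syms_cons.
rewrite IHv syms_cons (syms_map deg_p) -fsumD.
by apply: eq_fsum => u; rewrite mark_ins.
Qed.

Lemma mark_splits v H :
  mark (fun w => fsum (splits w) H) v =
  fsum (splits v) (fun r => mark (fun c => H (c, map p r.2)) r.1 +
    mark (fun d => H (map p r.1, d)) r.2).
Proof.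
elim: v H => [|x v IHv] H; first by rewrite splits_nil !mark_nil addr0.
have markx : mark (fun w => fsum (splits (p x :: w)) H) v =
    mark (fun w => H ([::], p x :: w)) v +
    mark (fun w => fsum (splits w) (fun r => H (p x :: r.1, r.2))) v.
  by rewrite -markD; apply: eq_mark => a y b _; rewrite splits_cons.
rewrite mark_cons markx IHv !splits_cons mark_nil add0r mark_cons.
rewrite splits_map -!addrA /=; congr (_ + _).
rewrite addrCA -fsumD; congr (_ + _); apply: eq_fsum => r.
by rewrite mark_cons addrA.
Qed.

End Mark.

(** * Extension by zero, and the structure map on A (+) M *)

Section DirectSum.
Variables (K : fieldType) (A M : gvect K).
Notation V := (gsum A M).
Notation word := (seq (helt V)).
Notation inlh := (@inl_h K A M).
Notation inrh := (@inr_h K A M).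
Notation prl := (@prl_h K A M).
Notation prr := (@prr_h K A M).

Definition toA (x : helt V) : helt V := inlh (prl x).
Definition toM (x : helt V) : helt V := inrh (prr x).

Lemma linear_snd e : linear (snd : V e -> M e). Proof. by []. Qed.

Lemma linear_pair0 (U : lmodType K) e (f : U -> A e) :
  linear f -> linear (fun x => (f x, 0) : V e).
Proof.
by move=> fl c x y; congr (_, _); rewrite ?fl //= scaler0 addr0.
Qed.

Lemma linear_0pair (U : lmodType K) e (f : U -> M e) :
  linear f -> linear (fun x => (0, f x) : V e).
Proof.
by move=> fl c x y; congr (_, _); rewrite ?fl //= scaler0 addr0.
Qed.

Lemma prl_inlK : cancel inlh prl. Proof. by case. Qed.
Lemma prr_inrK : cancel inrh prr. Proof. by case. Qed.

Lemma map_prl_toA a : map prl (map toA a) = map prl a.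
Proof. by rewrite -map_comp; apply: eq_map => x; rewrite /= prl_inlK. Qed.

Lemma map_toA a : map toA a = map inlh (map prl a).
Proof. by rewrite -map_comp. Qed.

Section MapOnA.
Variables (E : lmodType K) (F : seq (helt A) -> E).

Lemma mlin_map_prl : mlin F -> mlin (fun w => F (map prl w)).
Proof. by move=> Fl u w d a x y; rewrite !map_cat /= Fl. Qed.

Lemma map_prl_toM a y b : mlin F -> F (map prl (a ++ toM y :: b)) = 0.
Proof.
by move=> Fl; rewrite map_cat /=; apply: (linear_at0 (Fl _ _ _)).
Qed.

End MapOnA.

Lemma multilinear_extA mu : multilinear mu -> multilinear (@extA K A M mu).
Proof.
move=> /multilinearP mul u w d e; apply: (linear_pair0 (f := fun x : V d => _)).
exact: (mlin_map_prl (mul e)).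
Qed.

Lemma multilinear_extMA T : multilinear T -> multilinear (@extMA K A M T).
Proof.
move=> Tl u w d e; apply: (linear_pair0 (f := fun x : V d => _)) => a x y.
by rewrite !map_cat /= Tl.
Qed.

Lemma Psi_extA mu : eqm (Psi (@extA K A M mu)) (extA (Psi mu)).
Proof.
move=> v e; rewrite PsiE /extA PsiE (syms_map (h := prl)) //.
by rewrite [RHS](linear_fsum (f := fun z => (z, 0) : V e)) //;
  exact: linear_pair0.
Qed.

Lemma Psi_extMA T : eqm (Psi (@extMA K A M T)) (extMA (Psi T)).
Proof.
move=> v e; rewrite PsiE /extMA PsiE (syms_map (h := prr)) //.
by rewrite [RHS](linear_fsum (f := fun z => (z, 0) : V e)) //;
  exact: linear_pair0.
Qed.

Lemma projMA_Psi X : eqm (projMA (Psi X)) (Psi (@projMA K A M X)).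
Proof.
move=> v e; rewrite /projMA !PsiE (syms_map (h := inrh)) //.
by rewrite (linear_fsum (f := fst)).
Qed.

Section Bimodule.
Variable eta : bimap A M.
Hypothesis eta_bi : is_bimap eta.

Lemma extB_psum v e :
  extB eta v e = (0, psum v (fun a x b => eta (map prl a) (prr x) (map prl b) e)).
Proof. by congr (_, _); apply: psum_tnth. Qed.

Lemma multilinear_extB : multilinear (extB eta).
Proof.
have [eta1 eta2 eta3 _] := eta_bi.
move=> u w d e a x y; rewrite !extB_psum; move: a x y.
apply: (linear_0pair (f := fun x : V d => _)).
apply: (mlin_psum (G := fun a x b => eta (map prl a) (prr x) (map prl b) e)).
- move=> y b; apply: (mlin_map_prl (F := fun a => eta a _ _ _)) => u' w' d'.
  exact: eta1.
- by move=> a b d' c x y; exact: eta2.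
- move=> a y; apply: (mlin_map_prl (F := fun b => eta _ _ b _)) => u' w' d'.
  exact: eta3.
Qed.

Lemma extB_toA v e : extB eta (map toA v) e = 0.
Proof.
have [_ eta2 _ _] := eta_bi.
rewrite extB_psum psum_map /psum; congr (_, _); rewrite -[RHS](fsum0 _ (pt v)).
by apply: eq_fsum => t; apply: (linear_at0 (eta2 _ _ _ _)).
Qed.

Lemma extB_toM a x b e :
  (extB eta (map toA a ++ toM x :: map toA b) e).2 =
  eta (map prl a) (prr x) (map prl b) e.
Proof.
have [_ eta2 _ _] := eta_bi.
have z u y w : eta u (prr (toA y)) w e = 0 by apply: (linear_at0 (eta2 _ _ _ _)).
rewrite extB_psum /= psum_cat psum_cons !psum_map /psum.
under eq_fsum => t do rewrite z.
under [X in _ + (_ + X)]eq_fsum => t do rewrite z.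
by rewrite !fsum0 add0r addr0 cats0 !map_prl_toA /toM prr_inrK.
Qed.

(** On a word with one letter in M, distinguishing any other letter feeds [eta] a zero M-component,
    so a single term survives. *)
Lemma mark_extB v e :
  mark toA toM (fun w => (extB eta w e).2) v = (extB eta v e).2.
Proof. by rewrite extB_psum; apply: eq_psum => a x b _; exact: extB_toM. Qed.

Lemma extB_degree v e : e != 1 + degs v -> (extB eta v e).2 = 0.
Proof.
have [_ _ _ eta4] := eta_bi.
move=> ve; rewrite extB_psum -[RHS](fsum0 _ (pt v)).
apply: (@eq_psum _ _ _ v _ (fun _ _ _ => 0)) => a x b vE.
apply: eta4; move: ve.
by rewrite !degs_map // vE degs_cat degs_cons (addrA (degs a)).
Qed.

Lemma symm_repE u m e :
  symm_rep eta u m e =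
  fsum (syms (map inlh u ++ [:: inrh m])) (fun w => (extB eta w e).2).
Proof.
by rewrite /symm_rep PsiE -cats1 (linear_fsum (f := snd)).
Qed.

Let mlin_extB2 e : mlin (fun w => (extB eta w e).2).
Proof. by move=> u w d a x y; rewrite multilinear_extB. Qed.

Lemma is_repmap_symm_rep : is_repmap (symm_rep eta).
Proof.
split.
- move=> u1 u2 m d e a x y; rewrite !symm_repE !map_cat -!catA /=.
  rewrite -(mlin_syms (mlin_extB2 e)) /=.
  by congr (fsum (syms (_ ++ _ :: _)) _); congr helem;
    exact: (linear_pair0 (f := fun z => z)).
- move=> u d e a x y; rewrite !symm_repE.
  rewrite -(mlin_syms (mlin_extB2 e)) /=.
  by congr (fsum (syms (_ ++ [:: _])) _); congr helem;
    exact: (linear_0pair (f := fun z => z)).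
- move=> u s m e; apply: (gsym_koszul s (F := fun u => symm_rep eta u m e)).
  move=> u' x y w; rewrite !symm_repE !map_cat -!catA /=.
  exact: gsym_syms.
- move=> u m e ume; rewrite symm_repE.
  rewrite -[RHS](fsum0 _ (syms (map inlh u ++ [:: inrh m]))).
  apply: eq_syms => w _ dw; apply: extB_degree; rewrite dw.
  by rewrite degs_cat degs_map // degs_cons degs_nil addr0.
Qed.

(** Moving the distinguished letter to the end, as [extR] does, is undone by the graded symmetry of
    the sum over permutations. What remains is that [mark] commutes with [syms] and fixes the
    M-component of [extB]. *)
Lemma Psi_extB : eqm (Psi (extB eta)) (extR (symm_rep eta)).
Proof.
move=> v e; rewrite PsiE /extR.
rewrite (psum_tnth v (fun a x b => ksg K (deg x) (degs b) *:
   symm_rep eta (map prl (a ++ b)) (prr x) e)).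
have -> : psum v (fun a x b => ksg K (deg x) (degs b) *:
      symm_rep eta (map prl (a ++ b)) (prr x) e) =
    mark toA toM (fun w => fsum (syms w) (fun u => (extB eta u e).2)) v.
  apply: eq_psum => a x b _; rewrite symm_repE !map_cat -!map_comp -catA.
  have := gsym_move (map toA a) (toM x) (map toA b) [::]
    (@gsym_syms _ _ _ (fun u => (extB eta u e).2)).
  by rewrite cats0 degs_map // => ->.
rewrite mark_syms // (eq_fsum _ (fun w => mark_extB w e)).
rewrite (linear_fsum (f := fun z => (0, z) : V e)); last exact: linear_0pair.
by apply: eq_fsum => w; rewrite extB_psum.
Qed.

Variable mu : mmap A A.
Hypothesis mu_lin : multilinear mu.
Notation tri := (triT mu eta).

Lemma triT1 v e : (tri v e).1 = mu (map prl v) e.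
Proof. exact: addr0. Qed.

Lemma triT2 v e : (tri v e).2 = (extB eta v e).2.
Proof. exact: add0r. Qed.

Lemma multilinear_triT : multilinear tri.
Proof.
move=> u w d e; apply: linear_addf; first exact: multilinear_extA.
exact: multilinear_extB.
Qed.

Lemma Psi_triT : eqm (Psi tri) (triS (Psi mu) (symm_rep eta)).
Proof.
move=> v e; rewrite PsiE /triT /triS /addm fsumD -!PsiE.
by rewrite Psi_extA Psi_extB.
Qed.

Lemma circT_triT1 v e :
  (circT 1 tri tri v e).1 = circT 1 mu mu (map prl v) e.
Proof.
rewrite !circTE splits_map (linear_fsum (f := fst)) //; apply: eq_fsum => -[c r].
rewrite splits_map (linear_fsum (f := fst)) //; apply: eq_fsum => -[a d] /=.
rewrite size_map degs_map //; case: ifP => // _.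
rewrite -[LHS]/(ksg K 1 (degs c) *: (tri _ e).1) triT1 map_cat /=.
congr (_ *: mu (_ ++ _ :: _) _).
rewrite (@hvalE _ _ _ _ mu _ (1 + degs a)) ?degs_map //.
by rewrite -triT1.
Qed.

Lemma hval_triT_toA a : hval 1 tri (map toA a) = toA (hval 1 tri a).
Proof.
rewrite (@hvalE _ _ _ _ tri _ (1 + degs a)) ?degs_map //.
congr helem; rewrite [LHS]surjective_pairing triT1 triT2 extB_toA map_prl_toA.
by rewrite -triT1.
Qed.

(** The letter in M lies before, inside or after the inner block. Outside it, the inner value lies
    in A; inside it, the inner value lies in M and becomes the distinguished letter of the outer
    word. *)
Lemma mark_tri e (F : word -> M e) c a d :
  F =1 (fun w => (tri w e).2) ->
  mark toA toM (fun w => F (w ++ hval 1 tri (map toA a) :: map toA d)) c +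
  (mark toA toM (fun w => F (map toA c ++ hval 1 tri w :: map toA d)) a +
   mark toA toM (fun w => F (map toA c ++ hval 1 tri (map toA a) :: w)) d) =
  F (c ++ hval 1 tri a :: d).
Proof.
move=> Ftri.
have FE w : mark toA toM F w = F w.
  rewrite Ftri triT2 -mark_extB; apply: eq_mark => ? ? ? _.
  by rewrite Ftri triT2.
rewrite -[RHS]FE mark_cat -addrA; congr (_ + _); last congr (_ + _).
- by apply: eq_mark => ? ? ? _; rewrite hval_triT_toA.
(* With a letter of M inside the block, the A-component of the inner value vanishes; G is the outer
   map as a function of the M-component z. *)
- pose G z := F (map toA c ++ helem ((0, z) : V (1 + degs a)) :: map toA d).
  transitivity (mark toA toM (fun w => G (tri w (1 + degs a)).2) a).
    apply: eq_mark => b x b' aE; congr (F (_ ++ _ :: _)).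
    rewrite (@hvalE _ _ _ _ tri _ (1 + degs a)); last first.
      by rewrite degs_mark // aE.
    congr helem; rewrite [LHS]surjective_pairing triT1.
    by rewrite (map_prl_toM _ _ _ (F := mu^~ (1 + degs a))) //; apply/multilinearP.
  (* Linearity of G, shown last, brings the sum over the marked letter of a inside the outer map. *)
  rewrite /mark /psum -(linear_fsum (f := G)).
    rewrite -[fsum _ _]/(mark toA toM (fun w => (tri w (1 + degs a)).2) a).
    rewrite -[RHS]/(G (tri a (1 + degs a)).2); congr G.
    by rewrite triT2 -mark_extB; apply: eq_mark => ? ? ? _; rewrite triT2.
  move=> k x y; rewrite /G !Ftri -linear_snd -multilinear_triT.
  by congr (tri (_ ++ helem _ :: _) e).2; exact: (linear_0pair (f := fun z => z)).
- by apply: eq_mark => ? ? ? _; rewrite hval_triT_toA.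
Qed.

Lemma circT_triT2 v e :
  mark toA toM (fun w => (circT 1 tri tri w e).2) v = (circT 1 tri tri v e).2.
Proof.
(* Passing through an existential makes F opaque, so that it stays folded below. *)
have [F Ftri] : exists F : word -> M e, F =1 fun w => (tri w e).2 by eexists.
pose B c a d := if size a == 0 then 0 else
  ksg K 1 (degs c) *: F (c ++ hval 1 tri a :: d).
have circ2 w : (circT 1 tri tri w e).2 =
    fsum (splits w) (fun p => fsum (splits p.2) (fun q => B p.1 q.1 q.2)).
  rewrite circTE (linear_fsum (f := snd)) //; apply: eq_fsum => p.
  rewrite (linear_fsum (f := snd)) //; apply: eq_fsum => q.
  by rewrite /B Ftri; case: ifP.
transitivity (mark toA toM (fun w => fsum (splits w) (fun p =>
    fsum (splits p.2) (fun q => B p.1 q.1 q.2))) v).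
  by apply: eq_mark => a x b _; rewrite circ2.
rewrite circ2 mark_splits; apply: eq_fsum => -[c r] /=.
rewrite mark_splits mark_fsum splits_map -fsumD; apply: eq_fsum => -[a d] /=.
have mark0 w : mark toA toM (fun=> 0 : M e) w = 0 by exact: fsum0.
case: a => [|y a].
  rewrite [mark _ _ _ [::]]mark_nil add0r -[RHS]addr0.
  by congr (_ + _); [exact: (mark0 c) | exact: (mark0 d)].
have: size (y :: a) != 0 by []; move: (y :: a) => {y}{}a a0.
rewrite /B (negbTE a0) -(mark_tri _ _ _ Ftri) !scalerDr -!markZ.
congr (_ + (_ + _)).
- by apply: eq_mark => b x b' cE; rewrite size_map (negbTE a0) degs_mark // cE.
- apply: eq_mark => b x b' _.
  by rewrite size_cat /= addnS degs_map.
- by apply: eq_mark => b x b' _; rewrite size_map (negbTE a0) degs_map.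
Qed.

End Bimodule.

End DirectSum.

Theorem proposition7p8 (K : fieldType) (char0 : [pchar K] =i pred0)
    (A M : gvect K) (mu : mmap A A) (eta : bimap A M) (T : mmap M A)
    (hA : is_Ainf mu) (hM : is_bimodule mu eta)
    (hT : is_rRB_Ainf mu eta T) :
  is_rRB_Linf (Psi mu) (symm_rep eta) (Psi T).
Proof.
have [[mul _] mu0] := hA; have [eta_bi eta0] := hM.
have [_ _ [Tl Td] Tseries] := hT.
have tril := multilinear_triT eta_bi mul.
have extTl := multilinear_extMA (A := A) Tl.
split; [exact: Linf_Psi | | exact: HomS_Psi |].
  split; first exact: is_repmap_symm_rep.
  move=> v e v0.
  rewrite -(eq_brS 1 1 (Psi_triT eta_bi mu) (Psi_triT eta_bi mu)) brS_Psi // PsiE.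
  rewrite -[RHS](fsum0 _ (syms v)); apply: eq_syms => w sw _.
  (* Both terms of the bracket of the structure map with itself are this composite. *)
  suff tri0 : circT 1 (triT mu eta) (triT mu eta) w e = 0.
    by rewrite /brT tri0 scaler0 subr0.
  (* The A-component is the identity of A on the A-components of w; the M-component is a sum over
     words with one letter in M, where the bimodule identity applies. *)
  rewrite [LHS]surjective_pairing circT_triT1 mu0; last first.
    by rewrite -size_eq0 size_map sw size_eq0.
  rewrite -circT_triT2 //; congr (_, _).
  rewrite -[RHS](fsum0 _ (pt w)).
  apply: (@eq_psum _ _ _ w _ (fun _ _ _ => 0)) => a x b _.
  by rewrite !map_toA /toM eta0.
have iterl n : multilinear (iterbrT (extMA T) (triT mu eta) n).
  by elim: n => [|n IHn] //=; apply: multilinear_brT.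
have iterE n : eqm
    (iterbrS (extMA (Psi T)) (triS (Psi mu) (symm_rep eta)) n)
    (Psi (iterbrT (extMA T) (triT mu eta) n)).
  elim: n => [|n IHn] v e /=; first by rewrite Psi_triT.
  rewrite (eq_brS 1 0 IHn (fun v e => esym (Psi_extMA T v e))).
  exact: brS_Psi.
(* Permuting a word keeps its length, so the truncation bound N given for T in arity k also serves
   for [Psi T]. *)
move=> k k0; have [N TN] := Tseries k k0; exists N => p Np v e vk.
have -> : \sum_(1 <= n < p) (n`!%:R : K)^-1 *: projMA
      (iterbrS (extMA (Psi T)) (triS (Psi mu) (symm_rep eta)) n) v e =
    fsum (syms v) (fun w => \sum_(1 <= n < p) (n`!%:R : K)^-1 *:
      projMA (iterbrT (extMA T) (triT mu eta) n) w e).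
  rewrite fsum_sum; apply: eq_bigr => n _.
  by rewrite fsumZ -PsiE -projMA_Psi /projMA iterE.
rewrite -[RHS](fsum0 _ (syms v)); apply: eq_syms => w sw _.
by rewrite TN // sw.
Qed.
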